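(* If $f,g:A\vdash B$ are arrow terms of $\mathbf{L}_{\top,\bot}$ such that $Gf=Gg$ and either $A$ is $\bot$-normal or $B$ is $\top$-normal, then $f=g$ in $\mathbf{L}_{\top,\bot}$.
   Context: Formulae: $\mathcal{L}_{\top,\bot}$ is the set of formulae built from infinitely many propositional letters and the propositional constants $\top,\bot$ with the binary connectives $\wedge$ and $\vee$; $\xi$ stands for either $\wedge$ or $\vee$. The category $\mathbf{L}_{\top,\bot}$: its objects are the formulae of $\mathcal{L}_{\top,\bot}$. Arrow terms are typed expressions, where $f:A\vdash B$ means that $f$ has source $A$ and target $B$. For all formulae $A,A_1,A_2$ and $i\in\{1,2\}$ the primitive arrow terms are $\mathbf{1}_A:A\vdash A$, $\hat w_A:A\vdash A\wedge A$, $\check w_A:A\vee A\vdash A$, $\hat k^i_{A_1,A_2}:A_1\wedge A_2\vdash A_i$, $\check k^i_{A_1,A_2}:A_i\vdash A_1\vee A_2$, $\hat\kappa_A:A\vdash\top$, $\check\kappa_A:\bot\vdash A$. If $f:A\vdash B$ and $g:B\vdash C$ are arrow terms, so is $g\circ f:A\vdash C$; if $f_j:A_j\vdash B_j$ ($j=1,2$) are arrow terms, so is $f_1\mathbin{\xi}f_2:A_1\mathbin{\xi}A_2\vdash B_1\mathbin{\xi}B_2$. The equations of $\mathbf{L}_{\top,\bot}$ are the smallest set of equations between arrow terms of the same type that contains all instances of $f=f$ and of the following, and is closed under symmetry, transitivity and congruence with respect to $\circ$, $\wedge$ and $\vee$ on arrow terms: categorial: $f\circ\mathbf{1}_A=\mathbf{1}_B\circ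 f=f$ for $f:A\vdash B$, $h\circ(g\circ f)=(h\circ g)\circ f$; bifunctorial: $\mathbf{1}_A\mathbin{\xi}\mathbf{1}_B=\mathbf{1}_{A\xi B}$, $(g_1\circ f_1)\mathbin{\xi}(g_2\circ f_2)=(g_1\mathbin{\xi}g_2)\circ(f_1\mathbin{\xi}f_2)$; naturality (for $f:A\vdash B$, $f_j:A_j\vdash B_j$): $(f\wedge f)\circ\hat w_A=\hat w_B\circ f$, $f\circ\check w_A=\check w_B\circ(f\vee f)$, $f_i\circ\hat k^i_{A_1,A_2}=\hat k^i_{B_1,B_2}\circ(f_1\wedge f_2)$, $(f_1\vee f_2)\circ\check k^i_{A_1,A_2}=\check k^i_{B_1,B_2}\circ f_i$; triangular: $\hat k^i_{A,A}\circ\hat w_A=\mathbf{1}_A$, $\check w_A\circ\check k^i_{A,A}=\mathbf{1}_A$, $(\hat k^1_{A,B}\wedge\hat k^2_{A,B})\circ\hat w_{A\wedge B}=\mathbf{1}_{A\wedge B}$, $\check w_{A\vee B}\circ(\check k^1_{A,B}\vee\check k^2_{A,B})=\mathbf{1}_{A\vee B}$; terminal/initial: $\hat\kappa_A=f$ for every $f:A\vdash\top$, $\check\kappa_A=g$ for every $g:\bot\vdash A$; $\hat k^1_{\bot,\bot}=\hat k^2_{\bot,\bot}$ and $\check k^1_{\top,\top}=\check k^2_{\top,\top}$. Arrows of $\mathbf{L}_{\top,\bot}$ are equivalence classes of arrow terms modulo these equations. A formula $C$ of $\mathcal{L}_{\top,\bot}$ is a contradiction when there is in $\mathbf{L}_{\top,\bot}$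 an arrow of type $C\vdash\bot$; it is a tautology when there is in $\mathbf{L}_{\top,\bot}$ an arrow of type $\top\vdash C$. A formula is $\bot$-normal when for every subformula of it of the form $D\wedge C$ or $C\wedge D$ with $C$ a contradiction, there is no occurrence of $\vee$ in $D$. A formula is $\top$-normal when for every subformula of it of the form $D\vee C$ or $C\vee D$ with $C$ a tautology, there is no occurrence of $\wedge$ in $D$. The category $\mathit{Rel}$ and the functor $G$: objects of $\mathit{Rel}$ are the formulae of $\mathcal{L}_{\top,\bot}$; an arrow $R:A\vdash B$ is a binary relation from the set of occurrences of propositional letters in $A$ to the set of occurrences of propositional letters in $B$ (constants $\top,\bot$ are not letters); composition is $R_2\circ R_1=\{(x,y)\mid\exists z\,(xR_1z\text{ and }zR_2y)\}$, identities are identity relations. Let $|A|$ be the number of letter occurrences in $A$ and $x_j(A)$ the $j$-th one from the left. $R_1\mathbin{\xi}R_2$ is the disjoint union of $R_1$ and $R_2$ placed side by side: it consists of the pairs $(x_j(A_1\xi A_2),x_k(B_1\xi B_2))$ with $(x_j(A_1),x_k(B_1))\in R_1$ and $(x_{j+|A_1|}(A_1\xi A_2),x_{k+|B_1|}(B_1\xi B_2))$ with $(x_j(A_2),x_k(B_2))\in R_2$. The functor $G:\mathbf{L}_{\top,\bot}\to\mathit{Rel}$ is the identity on objects, preserves identities, $\circ$, $\wedge$, $\vee$, and satisfies: $(x_j(A),x_k(A\wedge A))\in G\hat w_A$ iff $(x_k(A\vee A),x_j(A))\in G\check w_A$ iff $j\equiv k\pmod{|A|}$; $(x_j(A_1\wedge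 A_2),x_k(A_1))\in G\hat k^1_{A_1,A_2}$ iff $(x_k(A_1),x_j(A_1\vee A_2))\in G\check k^1_{A_1,A_2}$ iff $j=k$; $(x_j(A_1\wedge A_2),x_k(A_2))\in G\hat k^2_{A_1,A_2}$ iff $(x_k(A_2),x_j(A_1\vee A_2))\in G\check k^2_{A_1,A_2}$ iff $j=k+|A_1|$; and $G\hat\kappa_A=G\check\kappa_A=\emptyset$. *)

(* Defs.v *)
From mathcomp Require Import all_boot.

Set Implicit Arguments.
Unset Strict Implicit.
Unset Printing Implicit Defensive.

Inductive conn := Conj | Disj.

Inductive formula :=
| Letter of nat
| Top
| Bot
| Bin of conn & formula & formula.

Declare Scope form_scope.
Delimit Scope form_scope with F.
Bind Scope form_scope with formula.

Notation "⊤" := Top : form_scope.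
Notation "⊥" := Bot : form_scope.
Notation "A ∧ B" := (Bin Conj A B)
  (at level 40, left associativity) : form_scope.
Notation "A ∨ B" := (Bin Disj A B)
  (at level 45, left associativity) : form_scope.

Reserved Notation "A ⊢ B" (at level 70, no associativity).
Reserved Notation "f ≡ g" (at level 70, no associativity).

(* The prefixes h and c stand for the hat and the check (inverted hat) placed
   over w, k and kappa, i.e. for the conjunctive and disjunctive versions. *)
Inductive arr : formula -> formula -> Type :=
| Id A : A ⊢ A
| hw A : A ⊢ A ∧ A
| cw A : A ∨ A ⊢ A
| hk1 A1 A2 : A1 ∧ A2 ⊢ A1
| hk2 A1 A2 : A1 ∧ A2 ⊢ A2
| ck1 A1 A2 : A1 ⊢ A1 ∨ A2
| ck2 A1 A2 : A2 ⊢ A1 ∨ A2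
| hkappa A : A ⊢ ⊤
| ckappa A : ⊥ ⊢ A
| Comp A B C (g : B ⊢ C) (f : A ⊢ B) : A ⊢ C
| Par (xi : conn) A1 A2 B1 B2 (f1 : A1 ⊢ B1) (f2 : A2 ⊢ B2) :
    Bin xi A1 A2 ⊢ Bin xi B1 B2
where "A ⊢ B" := (arr A%F B%F).

Declare Scope arr_scope.
Delimit Scope arr_scope with A.
Bind Scope arr_scope with arr.

Notation "g ∘ f" := (Comp g f) (at level 30, right associativity) : arr_scope.
Notation "f ∧ g" := (Par Conj f g)
  (at level 40, left associativity) : arr_scope.
Notation "f ∨ g" := (Par Disj f g)
  (at level 45, left associativity) : arr_scope.

Inductive arr_eq : forall A B, A ⊢ B -> A ⊢ B -> Prop :=
| arr_refl A B (f : A ⊢ B) : f ≡ f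
| arr_sym A B (f g : A ⊢ B) : f ≡ g -> g ≡ f
| arr_trans A B (f g h : A ⊢ B) : f ≡ g -> g ≡ h -> f ≡ h
| cong_comp A B C (g g' : B ⊢ C) (f f' : A ⊢ B) :
    g ≡ g' -> f ≡ f' -> g ∘ f ≡ g' ∘ f'
| cong_par xi A1 A2 B1 B2 (f1 f1' : A1 ⊢ B1) (f2 f2' : A2 ⊢ B2) :
    f1 ≡ f1' -> f2 ≡ f2' -> Par xi f1 f2 ≡ Par xi f1' f2'
| cat_idr A B (f : A ⊢ B) : f ∘ Id A ≡ f
| cat_idl A B (f : A ⊢ B) : Id B ∘ f ≡ f
| cat_assoc A B C D (h : C ⊢ D) (g : B ⊢ C) (f : A ⊢ B) :
    h ∘ (g ∘ f) ≡ (h ∘ g) ∘ f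
| bif_id xi A B : Par xi (Id A) (Id B) ≡ Id (Bin xi A B)
| bif_comp xi A1 A2 B1 B2 C1 C2
    (g1 : B1 ⊢ C1) (f1 : A1 ⊢ B1) (g2 : B2 ⊢ C2) (f2 : A2 ⊢ B2) :
    Par xi (g1 ∘ f1) (g2 ∘ f2) ≡ Par xi g1 g2 ∘ Par xi f1 f2
| nat_hw A B (f : A ⊢ B) : (f ∧ f) ∘ hw A ≡ hw B ∘ f
| nat_cw A B (f : A ⊢ B) : f ∘ cw A ≡ cw B ∘ (f ∨ f)
| nat_hk1 A1 A2 B1 B2 (f1 : A1 ⊢ B1) (f2 : A2 ⊢ B2) :
    f1 ∘ hk1 A1 A2 ≡ hk1 B1 B2 ∘ (f1 ∧ f2)
| nat_hk2 A1 A2 B1 B2 (f1 : A1 ⊢ B1) (f2 : A2 ⊢ B2) :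
    f2 ∘ hk2 A1 A2 ≡ hk2 B1 B2 ∘ (f1 ∧ f2)
| nat_ck1 A1 A2 B1 B2 (f1 : A1 ⊢ B1) (f2 : A2 ⊢ B2) :
    (f1 ∨ f2) ∘ ck1 A1 A2 ≡ ck1 B1 B2 ∘ f1
| nat_ck2 A1 A2 B1 B2 (f1 : A1 ⊢ B1) (f2 : A2 ⊢ B2) :
    (f1 ∨ f2) ∘ ck2 A1 A2 ≡ ck2 B1 B2 ∘ f2
| tri_hk1 A : hk1 A A ∘ hw A ≡ Id A
| tri_hk2 A : hk2 A A ∘ hw A ≡ Id A
| tri_ck1 A : cw A ∘ ck1 A A ≡ Id A
| tri_ck2 A : cw A ∘ ck2 A A ≡ Id A
| tri_hw A B : (hk1 A B ∧ hk2 A B) ∘ hw (A ∧ B) ≡ Id (A ∧ B)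
| tri_cw A B : cw (A ∨ B) ∘ (ck1 A B ∨ ck2 A B) ≡ Id (A ∨ B)
| terminal A (f : A ⊢ ⊤) : hkappa A ≡ f
| initial A (g : ⊥ ⊢ A) : ckappa A ≡ g
| hk_bot : hk1 ⊥ ⊥ ≡ hk2 ⊥ ⊥
| ck_top : ck1 ⊤ ⊤ ≡ ck2 ⊤ ⊤
where "f ≡ g" := (arr_eq f%A g%A).

Definition contradiction (C : formula) : Prop := inhabited (C ⊢ ⊥).
Definition tautology (C : formula) : Prop := inhabited (⊤ ⊢ C).

Inductive subformula (C : formula) : formula -> Prop :=
| sub_refl : subformula C C
| sub_left xi A B : subformula C A -> subformula C (Bin xi A B)
| sub_right xi A B : subformula C B -> subformula C (Bin xi A B).

Fixpoint occurs_in (xi : conn) (A : formula) : Prop :=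
  if A is Bin zeta A1 A2 then
    xi = zeta \/ occurs_in xi A1 \/ occurs_in xi A2
  else False.

Definition bot_normal (A : formula) : Prop :=
  forall C D : formula, contradiction C ->
    subformula (D ∧ C) A \/ subformula (C ∧ D) A -> ~ occurs_in Disj D.

Definition top_normal (A : formula) : Prop :=
  forall C D : formula, tautology C ->
    subformula (D ∨ C) A \/ subformula (C ∨ D) A -> ~ occurs_in Conj D.

Fixpoint nletters (A : formula) : nat :=
  match A with
  | Letter _ => 1
  | Top | Bot => 0
  | Bin _ A1 A2 => nletters A1 + nletters A2
  end.

(* The letter occurrences of A are numbered from left to right, from 0. *)
Definition occ (A : formula) := 'I_(nletters A).

Definition Rel (A B : formula) := {set occ A * occ B}.

Definition rel_comp A B C (R2 : Rel B C) (R1 : Rel A B) : Rel A C :=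
  [set p | [exists z, ((p.1, z) \in R1) && ((z, p.2) \in R2)]].

Definition rel_par xi A1 A2 B1 B2 (R1 : Rel A1 B1) (R2 : Rel A2 B2) :
    Rel (Bin xi A1 A2) (Bin xi B1 B2) :=
  [set (lshift (nletters A2) p.1, lshift (nletters B2) p.2) | p in R1] :|:
  [set (rshift (nletters A1) p.1, rshift (nletters B1) p.2) | p in R2].

(* The congruences and equations below compare occurrence numbers in nat; they
   are the same for numberings from 0 and from 1. *)
Fixpoint G A B (f : A ⊢ B) : Rel A B :=
  match f in A ⊢ B return Rel A B with
  | Id A => [set p | p.1 == p.2]
  | hw A => [set p : occ A * occ (A ∧ A) | p.1 == p.2 %[mod nletters A]]
  | cw A => [set p : occ (A ∨ A) * occ A | p.1 == p.2 %[mod nletters A]]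
  | hk1 A1 A2 =>
      [set p : occ (A1 ∧ A2) * occ A1 | p.1 == p.2 :> nat]
  | hk2 A1 A2 =>
      [set p : occ (A1 ∧ A2) * occ A2 | p.1 == p.2 + nletters A1 :> nat]
  | ck1 A1 A2 =>
      [set p : occ A1 * occ (A1 ∨ A2) | p.2 == p.1 :> nat]
  | ck2 A1 A2 =>
      [set p : occ A2 * occ (A1 ∨ A2) | p.2 == p.1 + nletters A1 :> nat]
  | hkappa A => set0
  | ckappa A => set0
  | Comp _ _ _ g f => rel_comp (G g) (G f)
  | Par xi _ _ _ _ f1 f2 => rel_par xi (G f1) (G f2)
  end.

(* Main.v *)
From mathcomp Require Import all_boot.
From Stdlib Require Import Setoid Morphisms.
Require Import Defs.

Set Implicit Arguments.
Unset Strict Implicit.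
Unset Printing Implicit Defensive.

Local Open Scope arr_scope.

(** Every arrow of the category is a composite of pairings, copairings,
projections, injections and the unique arrows to [⊤] and from [⊥]
([cut_elimination]), so an arrow whose source is not a disjunction and whose
target is not a conjunction is, constants and single letters apart, either
[f' ∘ proj i] or [inj j ∘ f'] ([arr_shape]).  Sources that are disjunctions and
targets that are conjunctions are split by the universal properties, and one
argues by induction on the total size of source and target.  Two arrows
[f' ∘ proj i] and [g' ∘ proj i] with equal images under [G] are handled by the
induction hypothesis, and so are two arrows that end with the same injection.

Two projections (or injections) on opposite sides can only have equal images if
these images are empty.  The condition on [⊥ ∧ ⊥] makes all arrows to [⊥]
with the same source equal, and the condition on [⊤ ∨ ⊤] does the same for
arrows from [⊤].  An arrow with empty image factors through [⊥] or [⊤]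
([G_eq0_factors]), and therefore it is determined by its source and target
([G_eq0_unique]).

Normality serves for the remaining pair [f' ∘ proj i] and [inj j ∘ g'], both of
type [A1 ∧ A2 ⊢ B1 ∨ B2].  As the image of [g'] does not touch the conjunct that
[proj i] discards, either [g'] factors through [proj i] as well, or the
discarded conjunct is a contradiction ([source_within_factors]).  In the latter
case, if the source is ⊥-normal, the other conjunct contains no disjunction, and
then [f'] factors through an injection ([disj_free_factors]).  Each time both
arrows have taken the same shape, which was treated before.  The dual argument
works for a ⊤-normal target. *)

(** * Finite products and coproducts *)

#[local] Instance arr_eq_equiv A B : Equivalence (@arr_eq A B).
Proof.
split; [exact: arr_refl | exact: arr_sym | move=> f g h; exact: arr_trans].
Qed.

#[local] Instance Comp_proper A B C :
  Proper (@arr_eq B C ==> @arr_eq A B ==> @arr_eq A C) (@Comp A B C).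
Proof. by move=> g g' eg f f' ef; apply: cong_comp. Qed.

#[local] Instance Par_proper xi A1 A2 B1 B2 :
  Proper (@arr_eq A1 B1 ==> @arr_eq A2 B2 ==> @arr_eq _ _)
    (@Par xi A1 A2 B1 B2).
Proof. by move=> f f' ef g g' eg; apply: cong_par. Qed.

#[local] Hint Resolve arr_refl : core.

Definition pairing A B1 B2 (f1 : A ⊢ B1) (f2 : A ⊢ B2) : A ⊢ B1 ∧ B2 :=
  (f1 ∧ f2) ∘ hw A.

Definition copairing A1 A2 B (f1 : A1 ⊢ B) (f2 : A2 ⊢ B) : A1 ∨ A2 ⊢ B :=
  cw B ∘ (f1 ∨ f2).

(** Indexing the two projections and the two injections by a boolean lets one
statement cover the left and the right case; [~~ i] is the opposite side. *)
Definition side T (i : bool) (a1 a2 : T) := if i then a1 else a2.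

Definition proj i A1 A2 : A1 ∧ A2 ⊢ side i A1 A2 :=
  if i is true then hk1 A1 A2 else hk2 A1 A2.

Definition inj i A1 A2 : side i A1 A2 ⊢ A1 ∨ A2 :=
  if i is true then ck1 A1 A2 else ck2 A1 A2.

#[local] Instance pairing_proper A B1 B2 :
  Proper (@arr_eq A B1 ==> @arr_eq A B2 ==> @arr_eq _ _) (@pairing A B1 B2).
Proof. by move=> f f' ef g g' eg; rewrite /pairing ef eg. Qed.

#[local] Instance copairing_proper A1 A2 B :
  Proper (@arr_eq A1 B ==> @arr_eq A2 B ==> @arr_eq _ _) (@copairing A1 A2 B).
Proof. by move=> f f' ef g g' eg; rewrite /copairing ef eg. Qed.

Lemma hk1_pairing A B1 B2 (f1 : A ⊢ B1) (f2 : A ⊢ B2) :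
  hk1 B1 B2 ∘ pairing f1 f2 ≡ f1.
Proof. by rewrite /pairing cat_assoc -nat_hk1 -cat_assoc tri_hk1 cat_idr. Qed.

Lemma hk2_pairing A B1 B2 (f1 : A ⊢ B1) (f2 : A ⊢ B2) :
  hk2 B1 B2 ∘ pairing f1 f2 ≡ f2.
Proof. by rewrite /pairing cat_assoc -nat_hk2 -cat_assoc tri_hk2 cat_idr. Qed.

Lemma copairing_ck1 A1 A2 B (f1 : A1 ⊢ B) (f2 : A2 ⊢ B) :
  copairing f1 f2 ∘ ck1 A1 A2 ≡ f1.
Proof. by rewrite /copairing -cat_assoc nat_ck1 cat_assoc tri_ck1 cat_idl. Qed.

Lemma copairing_ck2 A1 A2 B (f1 : A1 ⊢ B) (f2 : A2 ⊢ B) :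
  copairing f1 f2 ∘ ck2 A1 A2 ≡ f2.
Proof. by rewrite /copairing -cat_assoc nat_ck2 cat_assoc tri_ck2 cat_idl. Qed.

Lemma pairing_comp A B C1 C2 (g1 : B ⊢ C1) (g2 : B ⊢ C2) (f : A ⊢ B) :
  pairing g1 g2 ∘ f ≡ pairing (g1 ∘ f) (g2 ∘ f).
Proof. by rewrite /pairing bif_comp -!cat_assoc nat_hw. Qed.

Lemma comp_copairing A1 A2 B C (g : B ⊢ C) (f1 : A1 ⊢ B) (f2 : A2 ⊢ B) :
  g ∘ copairing f1 f2 ≡ copairing (g ∘ f1) (g ∘ f2).
Proof. by rewrite /copairing bif_comp !cat_assoc nat_cw. Qed.

Lemma pairing_eta A B1 B2 (f : A ⊢ B1 ∧ B2) :
  pairing (hk1 B1 B2 ∘ f) (hk2 B1 B2 ∘ f) ≡ f.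
Proof. by rewrite -pairing_comp /pairing tri_hw cat_idl. Qed.

Lemma copairing_eta A1 A2 B (f : A1 ∨ A2 ⊢ B) :
  copairing (f ∘ ck1 A1 A2) (f ∘ ck2 A1 A2) ≡ f.
Proof. by rewrite -comp_copairing /copairing tri_cw cat_idr. Qed.

Lemma arr_to_top_unique A (f g : A ⊢ ⊤) : f ≡ g.
Proof. by rewrite -(terminal f) -(terminal g). Qed.

Lemma arr_from_bot_unique A (f g : ⊥ ⊢ A) : f ≡ g.
Proof. by rewrite -(initial f) -(initial g). Qed.

(** Both arrows are projections of their pairing, and the two projections of
[⊥ ∧ ⊥] coincide. *)
Lemma arr_to_bot_unique A (f g : A ⊢ ⊥) : f ≡ g.
Proof. by rewrite -(hk1_pairing f g) hk_bot hk2_pairing. Qed.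

Lemma arr_from_top_unique A (f g : ⊤ ⊢ A) : f ≡ g.
Proof. by rewrite -(copairing_ck1 f g) ck_top copairing_ck2. Qed.

Lemma eq_or_negb (i j : bool) : {i = j} + {~~ i = j}.
Proof. by case: i j => [] []; [left | right | right | left]. Qed.

(** * Cut elimination *)

(** The constructors speak of all arrow terms equal to a composition-free one,
so that the predicate passes to the quotient ([cutfree_arr_eq]). *)
Inductive cutfree : forall A B, A ⊢ B -> Prop :=
| cutfree_id p h : h ≡ Id (Letter p) -> cutfree h
| cutfree_top A (h : A ⊢ ⊤) : cutfree h
| cutfree_bot B (h : ⊥ ⊢ B) : cutfree h
| cutfree_pairing A B1 B2 (f1 : A ⊢ B1) (f2 : A ⊢ B2) h :
    cutfree f1 -> cutfree f2 -> h ≡ pairing f1 f2 -> cutfree h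
| cutfree_copairing A1 A2 B (f1 : A1 ⊢ B) (f2 : A2 ⊢ B) h :
    cutfree f1 -> cutfree f2 -> h ≡ copairing f1 f2 -> cutfree h
| cutfree_proj i A1 A2 B (f : side i A1 A2 ⊢ B) h :
    cutfree f -> h ≡ f ∘ proj i A1 A2 -> cutfree h
| cutfree_inj i A B1 B2 (f : A ⊢ side i B1 B2) h :
    cutfree f -> h ≡ inj i B1 B2 ∘ f -> cutfree h.

Lemma cutfree_arr_eq A B (f g : A ⊢ B) : cutfree f -> g ≡ f -> cutfree g.
Proof.
move=> cf; case: cf g => {A B f}.
- by move=> p h eh g eg; apply: cutfree_id; rewrite eg.
- by move=> *; apply: cutfree_top.
- by move=> *; apply: cutfree_bot.
- by move=> A B1 B2 f1 f2 h c1 c2 eh g eg;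
    apply: cutfree_pairing c1 c2 _; rewrite eg.
- by move=> A1 A2 B f1 f2 h c1 c2 eh g eg;
    apply: cutfree_copairing c1 c2 _; rewrite eg.
- by move=> i A1 A2 B f1 h c1 eh g eg; apply: cutfree_proj c1 _; rewrite eg.
- by move=> i A B1 B2 f1 h c1 eh g eg; apply: cutfree_inj c1 _; rewrite eg.
Qed.

Definition id_letter p q (e : p = q) : Letter p ⊢ Letter q :=
  ecast r (Letter p ⊢ Letter r) e (Id (Letter p)).

(** The shapes record the outermost rule of a cut-free arrow by recursion on the
formulae in its type, which replaces dependent inversion of [cutfree]. *)
Definition id_shape A B : A ⊢ B -> Prop :=
  match A, B with
  | Letter p, Letter q => fun f => exists e : p = q, f ≡ id_letter e
  | _, _ => fun _ => False
  end.

Definition left_shape A B : A ⊢ B -> Prop :=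
  match A with
  | Letter _ | Top => fun _ => False
  | Bot => fun _ => True
  | Bin Conj A1 A2 => fun f =>
      exists i (f' : side i A1 A2 ⊢ B), cutfree f' /\ f ≡ f' ∘ proj i A1 A2
  | Bin Disj A1 A2 => fun f =>
      exists (f1 : A1 ⊢ B) (f2 : A2 ⊢ B),
        [/\ cutfree f1, cutfree f2 & f ≡ copairing f1 f2]
  end.

Definition right_shape A B : A ⊢ B -> Prop :=
  match B with
  | Letter _ | Bot => fun _ => False
  | Top => fun _ => True
  | Bin Disj B1 B2 => fun f =>
      exists i (f' : A ⊢ side i B1 B2), cutfree f' /\ f ≡ inj i B1 B2 ∘ f'
  | Bin Conj B1 B2 => fun f =>
      exists (f1 : A ⊢ B1) (f2 : A ⊢ B2),
        [/\ cutfree f1, cutfree f2 & f ≡ pairing f1 f2]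
  end.

Lemma cutfree_shape A B (f : A ⊢ B) :
  cutfree f -> [\/ id_shape f, left_shape f | right_shape f].
Proof.
case=> {A B f} //=.
- by move=> p h eh; apply: Or31; exists erefl.
- by move=> *; apply: Or33.
- by move=> *; apply: Or32.
- by move=> A B1 B2 f1 f2 h *; apply: Or33; exists f1, f2.
- by move=> A1 A2 B f1 f2 h *; apply: Or32; exists f1, f2.
- by move=> i A1 A2 B f1 h *; apply: Or32; exists i, f1.
- by move=> i A B1 B2 f1 h *; apply: Or33; exists i, f1.
Qed.

Fixpoint formula_size A :=
  if A is Bin _ A1 A2 then (formula_size A1 + formula_size A2).+1 else 0.

Lemma size_side i xi A1 A2 :
  formula_size (side i A1 A2) < formula_size (Bin xi A1 A2).
Proof. by case: i => /=; rewrite ltnS ?leq_addr ?leq_addl. Qed.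

(** Either the composition is pushed into a premise of [f] or [g], or the middle
formula is introduced on both sides and the cut is replaced by one on a conjunct
or disjunct.  Each step shortens one of the three formulae involved and keeps
the other two, whence the measure. *)
Lemma cutfree_comp A B C (g : B ⊢ C) (f : A ⊢ B) :
  cutfree g -> cutfree f -> cutfree (g ∘ f).
Proof.
have [n] := ubnP (formula_size A + formula_size B + formula_size C).
elim: n => // n IHn in A B C g f *; rewrite ltnS => le_n cg cf.
have IH A' B' C' (g' : B' ⊢ C') (f' : A' ⊢ B') :
    cutfree g' -> cutfree f' ->
    formula_size A' + formula_size B' + formula_size C' <
      formula_size A + formula_size B + formula_size C -> cutfree (g' ∘ f').
  by move=> cg' cf' lt'; apply: IHn => //; apply: leq_trans le_n.
move: IH => {n IHn le_n}.
have [sf|sf|sf] := cutfree_shape cf.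
- case: A f sf {cf} => // p; case: B g cg => // q g cg f [e ef] _.
  case: _ / e g cg f ef => g cg f ef.
  by apply: cutfree_arr_eq cg _; rewrite ef cat_idr.
- case: A f sf {cf} => //=.
    by move=> *; apply: cutfree_bot.
  case=> A1 A2 f.
    case=> i [f' [cf' ef]] IH.
    apply: (@cutfree_proj i _ _ _ (g ∘ f')); last by rewrite ef cat_assoc.
    by apply: IH => //; rewrite !ltn_add2r (size_side i Conj).
  case=> [f1 [f2 [cf1 cf2 ef]]] IH.
  apply: (@cutfree_copairing _ _ _ (g ∘ f1) (g ∘ f2)).
  + by apply: IH => //; rewrite !ltn_add2r (size_side true Disj).
  + by apply: IH => //; rewrite !ltn_add2r (size_side false Disj).
  by rewrite ef comp_copairing.
have [sg|sg|sg] := cutfree_shape cg.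
- by case: B g f sf sg {cg} cf.
(* The middle formula is introduced by both arrows. *)
- case: B g f sf sg {cf cg} => //= -[] B1 B2 g f.
    case=> f1 [f2 [cf1 cf2 ef]] [[] [g' [cg' eg]]] IH.
      apply: (@cutfree_arr_eq _ _ (g' ∘ f1)).
        by apply: IH => //; rewrite ltn_add2r ltn_add2l (size_side true Conj).
      by rewrite eg ef -cat_assoc hk1_pairing.
    apply: (@cutfree_arr_eq _ _ (g' ∘ f2)).
      by apply: IH => //; rewrite ltn_add2r ltn_add2l (size_side false Conj).
    by rewrite eg ef -cat_assoc hk2_pairing.
  case=> [[] [f' [cf' ef]]] [g1 [g2 [cg1 cg2 eg]]] IH.
    apply: (@cutfree_arr_eq _ _ (g1 ∘ f')).
      by apply: IH => //; rewrite ltn_add2r ltn_add2l (size_side true Disj).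
    by rewrite eg ef cat_assoc copairing_ck1.
  apply: (@cutfree_arr_eq _ _ (g2 ∘ f')).
    by apply: IH => //; rewrite ltn_add2r ltn_add2l (size_side false Disj).
  by rewrite eg ef cat_assoc copairing_ck2.
case: C g sg {cg} => //=.
  by move=> *; apply: cutfree_top.
case=> C1 C2 g.
  case=> [g1 [g2 [cg1 cg2 eg]]] IH.
  apply: (@cutfree_pairing _ _ _ (g1 ∘ f) (g2 ∘ f)).
  + by apply: IH => //; rewrite ltn_add2l (size_side true Conj).
  + by apply: IH => //; rewrite ltn_add2l (size_side false Conj).
  by rewrite eg pairing_comp.
case=> i [g' [cg' eg]] IH.
apply: (@cutfree_inj i _ _ _ (g' ∘ f)); last by rewrite eg cat_assoc.
by apply: IH => //; rewrite ltn_add2l (size_side i Disj).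
Qed.

Lemma cutfree_Id A : cutfree (Id A).
Proof.
elim: A => [p|||[] A1 c1 A2 c2]; first exact: cutfree_id.
- exact: cutfree_top.
- exact: cutfree_bot.
- apply: (@cutfree_pairing _ _ _ (Id A1 ∘ hk1 A1 A2) (Id A2 ∘ hk2 A1 A2)).
  + exact: (@cutfree_proj true _ _ _ (Id A1)).
  + exact: (@cutfree_proj false _ _ _ (Id A2)).
  by rewrite !cat_idl /pairing tri_hw.
- apply: (@cutfree_copairing _ _ _ (ck1 A1 A2 ∘ Id A1) (ck2 A1 A2 ∘ Id A2)).
  + exact: (@cutfree_inj true _ _ _ (Id A1)).
  + exact: (@cutfree_inj false _ _ _ (Id A2)).
  by rewrite !cat_idr /copairing tri_cw.
Qed.

Lemma cut_elimination A B (f : A ⊢ B) : cutfree f.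
Proof.
have cid := cutfree_Id.
elim: f => {A B}.
- exact: cid.
- move=> A; apply: (cutfree_pairing (cid A) (cid A)).
  by rewrite /pairing bif_id cat_idl.
- move=> A; apply: (cutfree_copairing (cid A) (cid A)).
  by rewrite /copairing bif_id cat_idr.
- move=> A1 A2; apply: (@cutfree_proj true _ _ _ _ _ (cid A1)).
  by rewrite cat_idl.
- move=> A1 A2; apply: (@cutfree_proj false _ _ _ _ _ (cid A2)).
  by rewrite cat_idl.
- move=> A1 A2; apply: (@cutfree_inj true _ _ _ _ _ (cid A1)).
  by rewrite cat_idr.
- move=> A1 A2; apply: (@cutfree_inj false _ _ _ _ _ (cid A2)).
  by rewrite cat_idr.
- by move=> A; apply: cutfree_top.
- by move=> A; apply: cutfree_bot.
- by move=> A B C g cg f cf; apply: cutfree_comp.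
- case=> A1 A2 B1 B2 f1 c1 f2 c2.
    apply: (@cutfree_pairing _ _ _ (f1 ∘ hk1 A1 A2) (f2 ∘ hk2 A1 A2)).
    + exact: (@cutfree_proj true _ _ _ f1).
    + exact: (@cutfree_proj false _ _ _ f2).
    by rewrite /pairing bif_comp -cat_assoc tri_hw cat_idr.
  apply: (@cutfree_copairing _ _ _ (ck1 B1 B2 ∘ f1) (ck2 B1 B2 ∘ f2)).
  + exact: (@cutfree_inj true _ _ _ f1).
  + exact: (@cutfree_inj false _ _ _ f2).
  by rewrite /copairing bif_comp cat_assoc tri_cw cat_idl.
Qed.

Lemma arr_shape A B (f : A ⊢ B) :
  [\/ id_shape f, left_shape f | right_shape f].
Proof. exact/cutfree_shape/cut_elimination. Qed.

(** * Soundness of the interpretation in Rel *)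

Lemma mem_comp A B C (g : B ⊢ C) (f : A ⊢ B) x y :
  reflect (exists z, (x, z) \in G f /\ (z, y) \in G g) ((x, y) \in G (g ∘ f)).
Proof.
rewrite /= inE /=.
apply: (iffP existsP) => [[z /andP[]]|[z []]] *; exists z => //.
exact/andP.
Qed.

(** Writing every occurrence in a binary formula as [place i xi A1 A2 x] lets one
compute [G] without arithmetic on occurrence numbers. *)
Definition place i xi A1 A2 : occ (side i A1 A2) -> occ (Bin xi A1 A2) :=
  if i is true then @lshift (nletters A1) (nletters A2)
  else @rshift (nletters A1) (nletters A2).
Arguments place : clear implicits.

Lemma place_inj i xi A1 A2 : injective (place i xi A1 A2).
Proof. by case: i; [exact: lshift_inj | exact: rshift_inj]. Qed.

Lemma place_neq i xi A1 A2 x y : place i xi A1 A2 x != place (~~ i) xi A1 A2 y.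
Proof. by case: i x y => x y; [rewrite eq_lrshift | rewrite eq_rlshift]. Qed.

Variant place_spec i xi A1 A2 : occ (Bin xi A1 A2) -> Prop :=
| PlaceSame x : place_spec i (place i xi A1 A2 x)
| PlaceOther x : place_spec i (place (~~ i) xi A1 A2 x).

Lemma placeP i xi A1 A2 (x : occ (Bin xi A1 A2)) : place_spec i x.
Proof.
case: i; case: (split_ordP x) => x' ->.
- exact: (@PlaceSame true).
- exact: (@PlaceOther true).
- exact: (@PlaceOther false).
- exact: (@PlaceSame false).
Qed.

Lemma mem_Id A (x y : occ A) : ((x, y) \in G (Id A)) = (x == y).
Proof. by rewrite /= inE. Qed.

Lemma mem_hw A x y :
  (((x, place true Conj A A y) \in G (hw A)) = (x == y)) *
  (((x, place false Conj A A y) \in G (hw A)) = (x == y)).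
Proof. by split; rewrite /= inE /= ?modnDl !modn_small. Qed.

Lemma mem_cw A x y :
  (((place true Disj A A x, y) \in G (cw A)) = (x == y)) *
  (((place false Disj A A x, y) \in G (cw A)) = (x == y)).
Proof. by split; rewrite /= inE /= ?modnDl !modn_small. Qed.

Lemma mem_proj i A1 A2 x y :
  ((x, y) \in G (proj i A1 A2)) = (x == place i Conj A1 A2 y).
Proof. by case: i y => y; rewrite /= inE //= [(_ + nletters A1)%N]addnC. Qed.

Lemma mem_inj i A1 A2 x y :
  ((x, y) \in G (inj i A1 A2)) = (y == place i Disj A1 A2 x).
Proof. by case: i x => x; rewrite /= inE //= [(_ + nletters A1)%N]addnC. Qed.

Definition side_arr i A1 A2 B1 B2 (f1 : A1 ⊢ B1) (f2 : A2 ⊢ B2) :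
    side i A1 A2 ⊢ side i B1 B2 :=
  if i is true then f1 else f2.

Lemma mem_Par i xi A1 A2 B1 B2 (f1 : A1 ⊢ B1) (f2 : A2 ⊢ B2) x y :
  ((place i xi A1 A2 x, place i xi B1 B2 y) \in G (Par xi f1 f2)) =
  ((x, y) \in G (side_arr i f1 f2)).
Proof.
case: i x y => x y /=; apply/setUP/idP.
- case=> /imsetP[[x' y'] m e]; move: (congr1 fst e) (congr1 snd e) => /=.
    by move=> /lshift_inj -> /lshift_inj ->.
  by move/eqP; rewrite eq_lrshift.
- by move=> m; left; apply/imsetP; exists (x, y).
- case=> /imsetP[[x' y'] m e]; move: (congr1 fst e) (congr1 snd e) => /=.
    by move/eqP; rewrite eq_rlshift.
  by move=> /rshift_inj -> /rshift_inj ->.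
- by move=> m; right; apply/imsetP; exists (x, y).
Qed.

Lemma mem_Par_neq i xi A1 A2 B1 B2 (f1 : A1 ⊢ B1) (f2 : A2 ⊢ B2) :
  (forall x y,
    ((place i xi A1 A2 x, place (~~ i) xi B1 B2 y) \in G (Par xi f1 f2)) = false)
  * (forall x y,
    ((place (~~ i) xi A1 A2 x, place i xi B1 B2 y) \in G (Par xi f1 f2)) = false).
Proof.
split=> x y; apply/negP; case: i x y => x y /= /setUP[] /imsetP[[x' y'] m e];
  move: (congr1 fst e) (congr1 snd e) => /= /eqP + /eqP;
  by rewrite ?eq_lrshift ?eq_rlshift.
Qed.

Lemma sound_proj i A1 A2 B1 B2 (f1 : A1 ⊢ B1) (f2 : A2 ⊢ B2) :
  G (side_arr i f1 f2 ∘ proj i A1 A2) = G (proj i B1 B2 ∘ (f1 ∧ f2)).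
Proof.
apply/setP=> -[x y]; apply/mem_comp/mem_comp=> -[z []]; rewrite mem_proj.
  move=> /eqP -> m; exists (place i Conj B1 B2 y).
  by rewrite mem_Par mem_proj eqxx.
move=> m /eqP ez; move: m; rewrite {z}ez.
case: (placeP i x) => {}x; rewrite ?mem_Par ?mem_Par_neq //.
by exists x; rewrite mem_proj eqxx.
Qed.

Lemma sound_inj i A1 A2 B1 B2 (f1 : A1 ⊢ B1) (f2 : A2 ⊢ B2) :
  G ((f1 ∨ f2) ∘ inj i A1 A2) = G (inj i B1 B2 ∘ side_arr i f1 f2).
Proof.
apply/setP=> -[x y]; apply/mem_comp/mem_comp=> -[z []]; rewrite mem_inj.
  move=> /eqP ->; case: (placeP i y) => {}y; rewrite ?mem_Par ?mem_Par_neq //.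
  by exists y; rewrite mem_inj eqxx.
move=> m /eqP ->; exists (place i Disj A1 A2 x).
by rewrite mem_Par mem_inj eqxx.
Qed.

Definition mem_w := (mem_hw, mem_cw).

Lemma sound_hw A B (f : A ⊢ B) : G ((f ∧ f) ∘ hw A) = G (hw B ∘ f).
Proof.
apply/setP=> -[x y]; apply/mem_comp/mem_comp=> -[z []].
  case: (placeP true y) => {}y; case: (placeP true z) => {}z;
    rewrite ?mem_Par ?mem_Par_neq // mem_w => /eqP -> m;
    by exists y; rewrite mem_w.
move=> m; case: (placeP true y) => {}y; rewrite mem_w => /eqP <-.
  by exists (place true Conj A A x); rewrite mem_Par mem_w.
by exists (place false Conj A A x); rewrite mem_Par mem_w.
Qed.

Lemma sound_cw A B (f : A ⊢ B) : G (f ∘ cw A) = G (cw B ∘ (f ∨ f)).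
Proof.
apply/setP=> -[x y]; apply/mem_comp/mem_comp=> -[z []].
  case: (placeP true x) => {}x; rewrite mem_w => /eqP <-.
    by exists (place true Disj B B y); rewrite mem_Par mem_w.
  by exists (place false Disj B B y); rewrite mem_Par mem_w.
case: (placeP true x) => {}x; case: (placeP true z) => {}z;
    rewrite ?mem_Par ?mem_Par_neq // mem_w => m /eqP <-;
    by exists x; rewrite mem_w.
Qed.

Lemma G_sound A B (f g : A ⊢ B) : f ≡ g -> G f = G g.
Proof.
elim=> {A B f g}.
- by [].
- by [].
- by move=> A B f g h _ -> _ ->.
- by move=> A B C g g' f f' _ /= -> _ ->.
- by move=> xi A1 A2 B1 B2 f1 f1' f2 f2' _ /= -> _ ->.
- move=> A B f; apply/setP=> -[x y]; apply/mem_comp/idP => [[z []]|m].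
    by rewrite mem_Id => /eqP ->.
  by exists x; rewrite mem_Id.
- move=> A B f; apply/setP=> -[x y]; apply/mem_comp/idP => [[z []]|m].
    by rewrite mem_Id => m /eqP <-.
  by exists y; rewrite mem_Id.
- move=> A B C D h g f; apply/setP=> -[x y]; apply/mem_comp/mem_comp.
    case=> z [/mem_comp[t [mf mg]] mh]; exists t; split=> //.
    by apply/mem_comp; exists z.
  case=> t [mf /mem_comp[z [mg mh]]]; exists z; split=> //.
  by apply/mem_comp; exists t.
- move=> xi A B; apply/setP=> -[x y]; rewrite mem_Id.
  case: (placeP true x) => {}x; case: (placeP true y) => {}y;
   rewrite ?mem_Par ?mem_Par_neq.
  + by rewrite /= inE (inj_eq (@place_inj true _ _ _)).
  + by rewrite (negPf (place_neq _ _ _)).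
  + by rewrite eq_sym (negPf (place_neq _ _ _)).
  + by rewrite /= inE (inj_eq (@place_inj false _ _ _)).
- move=> xi A1 A2 B1 B2 C1 C2 g1 f1 g2 f2.
  apply/setP=> -[x y]; apply/idP/mem_comp.
    case: (placeP true x) => {}x; case: (placeP true y) => {}y;
      rewrite ?mem_Par ?mem_Par_neq // => /mem_comp [z [mf mg]].
      by exists (place true xi B1 B2 z); rewrite !mem_Par.
    by exists (place false xi B1 B2 z); rewrite !mem_Par.
  case=> z []; case: (placeP true x) => {}x; case: (placeP true z) => {}z;
   rewrite ?mem_Par ?mem_Par_neq // => mf;
   case: (placeP true y) => {}y; rewrite ?mem_Par ?mem_Par_neq // => mg;
   by apply/mem_comp; exists z.
- exact: sound_hw.
- exact: sound_cw.
- exact: (@sound_proj true).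
- exact: (@sound_proj false).
- exact: (@sound_inj true).
- exact: (@sound_inj false).
- move=> A; apply/setP=> -[x y]; rewrite mem_Id.
  apply/mem_comp/eqP => [[z [mw]]|->].
    rewrite (mem_proj (i := true)) => /eqP ez; move: mw.
    by rewrite ez mem_w => /eqP.
  by exists (place true Conj A A y); rewrite mem_w (mem_proj (i := true)).
- move=> A; apply/setP=> -[x y]; rewrite mem_Id.
  apply/mem_comp/eqP => [[z [mw]]|->].
    rewrite (mem_proj (i := false)) => /eqP ez; move: mw.
    by rewrite ez mem_w => /eqP.
  by exists (place false Conj A A y); rewrite mem_w (mem_proj (i := false)).
- move=> A; apply/setP=> -[x y]; rewrite mem_Id.
  apply/mem_comp/eqP => [[z []]|->].
    by rewrite (mem_inj (i := true)) => /eqP ->; rewrite mem_w => /eqP.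
  by exists (place true Disj A A y); rewrite mem_w (mem_inj (i := true)).
- move=> A; apply/setP=> -[x y]; rewrite mem_Id.
  apply/mem_comp/eqP => [[z []]|->].
    by rewrite (mem_inj (i := false)) => /eqP ->; rewrite mem_w => /eqP.
  by exists (place false Disj A A y); rewrite mem_w (mem_inj (i := false)).
- move=> A B; apply/setP=> -[x y]; rewrite mem_Id.
  apply/mem_comp/eqP => [[z []]|->].
    case: (placeP true y) => {}y; case: (placeP true z) => {}z;
      rewrite ?mem_Par ?mem_Par_neq // mem_w => /eqP <-.
      by rewrite (mem_proj (i := true)) => /eqP ->.
    by rewrite (mem_proj (i := false)) => /eqP ->.
  case: (placeP true y) => {}y.
    exists (place true Conj _ _ (place true Conj A B y)).
    by rewrite mem_w mem_Par (mem_proj (i := true)) !eqxx.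
  exists (place false Conj _ _ (place false Conj A B y)).
  by rewrite mem_w mem_Par (mem_proj (i := false)) !eqxx.
- move=> A B; apply/setP=> -[x y]; rewrite mem_Id.
  apply/mem_comp/eqP => [[z []]|->].
    case: (placeP true x) => {}x; case: (placeP true z) => {}z;
      rewrite ?mem_Par ?mem_Par_neq // mem_w => m /eqP <-; move: m.
      by rewrite (mem_inj (i := true)) => /eqP ->.
    by rewrite (mem_inj (i := false)) => /eqP ->.
  case: (placeP true y) => {}y.
    exists (place true Disj _ _ (place true Disj A B y)).
    by rewrite mem_w mem_Par (mem_inj (i := true)) !eqxx.
  exists (place false Disj _ _ (place false Disj A B y)).
  by rewrite mem_w mem_Par (mem_inj (i := false)) !eqxx.
- by move=> A f; apply/setP=> -[x []].
- by move=> A f; apply/setP=> -[[]].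
- by apply/setP=> -[[]].
- by apply/setP=> -[[]].
Qed.

(** * Arrows with empty relation *)

Lemma mem_comp_proj i A1 A2 B (f : side i A1 A2 ⊢ B) x y :
  ((place i Conj A1 A2 x, y) \in G (f ∘ proj i A1 A2)) = ((x, y) \in G f).
Proof.
apply/mem_comp/idP => [[z []]|m]; last by exists x; rewrite mem_proj.
by rewrite mem_proj => /eqP /place_inj ->.
Qed.

Lemma mem_comp_proj_neq i A1 A2 B (f : side i A1 A2 ⊢ B) x y :
  ((place (~~ i) Conj A1 A2 x, y) \in G (f ∘ proj i A1 A2)) = false.
Proof.
apply/mem_comp => -[z []].
by rewrite mem_proj eq_sym (negPf (place_neq _ _ _)).
Qed.

Lemma mem_inj_comp i A B1 B2 (f : A ⊢ side i B1 B2) x y :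
  ((x, place i Disj B1 B2 y) \in G (inj i B1 B2 ∘ f)) = ((x, y) \in G f).
Proof.
apply/mem_comp/idP => [[z []]|m]; last by exists y; rewrite mem_inj.
by rewrite mem_inj => m /eqP /place_inj ->.
Qed.

Lemma mem_inj_comp_neq i A B1 B2 (f : A ⊢ side i B1 B2) x y :
  ((x, place (~~ i) Disj B1 B2 y) \in G (inj i B1 B2 ∘ f)) = false.
Proof.
apply/mem_comp => -[z []].
by rewrite mem_inj eq_sym (negPf (place_neq _ _ _)).
Qed.

Lemma G_comp_proj_inj i A1 A2 B (f g : side i A1 A2 ⊢ B) :
  G (f ∘ proj i A1 A2) = G (g ∘ proj i A1 A2) -> G f = G g.
Proof.
by move=> e; apply/setP=> -[x y]; rewrite -!(mem_comp_proj (i := i)) e.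
Qed.

Lemma G_inj_comp_inj i A B1 B2 (f g : A ⊢ side i B1 B2) :
  G (inj i B1 B2 ∘ f) = G (inj i B1 B2 ∘ g) -> G f = G g.
Proof.
by move=> e; apply/setP=> -[x y]; rewrite -!(mem_inj_comp (i := i)) e.
Qed.

Lemma G_comp_proj_eq0 i A1 A2 B (f : side i A1 A2 ⊢ B) :
  G (f ∘ proj i A1 A2) = set0 -> G f = set0.
Proof.
by move=> e; apply/setP=> -[x y]; rewrite -(mem_comp_proj (i := i)) e !in_set0.
Qed.

Lemma G_inj_comp_eq0 i A B1 B2 (f : A ⊢ side i B1 B2) :
  G (inj i B1 B2 ∘ f) = set0 -> G f = set0.
Proof.
by move=> e; apply/setP=> -[x y]; rewrite -(mem_inj_comp (i := i)) e !in_set0.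
Qed.

Lemma G_comp_eq0 A B C (g : B ⊢ C) (f : A ⊢ B) :
  G g = set0 \/ G f = set0 -> G (g ∘ f) = set0.
Proof.
move=> e0; apply/setP=> -[x y]; rewrite in_set0; apply/mem_comp=> -[z []].
by case: e0 => ->; rewrite !in_set0.
Qed.

Lemma G_comp_proj_clash i A1 A2 B
    (f : side i A1 A2 ⊢ B) (g : side (~~ i) A1 A2 ⊢ B) :
  G (f ∘ proj i A1 A2) = G (g ∘ proj (~~ i) A1 A2) ->
  G (f ∘ proj i A1 A2) = set0.
Proof.
move=> e; apply/setP=> -[x y]; rewrite in_set0; case: (placeP i x) => {}x.
  rewrite e; case: i f g {e} x => f g x.
    exact: (mem_comp_proj_neq (i := false)).
  exact: (mem_comp_proj_neq (i := true)).
by rewrite mem_comp_proj_neq.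
Qed.

Lemma G_inj_comp_clash i A B1 B2
    (f : A ⊢ side i B1 B2) (g : A ⊢ side (~~ i) B1 B2) :
  G (inj i B1 B2 ∘ f) = G (inj (~~ i) B1 B2 ∘ g) ->
  G (inj i B1 B2 ∘ f) = set0.
Proof.
move=> e; apply/setP=> -[x y]; rewrite in_set0; case: (placeP i y) => {}y.
  rewrite e; case: i f g {e} y => f g y.
    exact: (mem_inj_comp_neq (i := false)).
  exact: (mem_inj_comp_neq (i := true)).
by rewrite mem_inj_comp_neq.
Qed.

Definition factors_bot A B (f : A ⊢ B) := exists h : A ⊢ ⊥, f ≡ ckappa B ∘ h.
Definition factors_top A B (f : A ⊢ B) := exists h : ⊤ ⊢ B, f ≡ h ∘ hkappa A.

(** If [A] is a contradiction, the unique arrow from [A] to [⊤] factors through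
[⊥], so that an arrow through [⊤] is also an arrow through [⊥]. *)
Lemma factors_contradiction A B (f : A ⊢ B) (h : A ⊢ ⊥) :
  factors_bot f \/ factors_top f -> f ≡ ckappa B ∘ h.
Proof.
case=> [[k ->]|[k ->]]; first by rewrite (arr_to_bot_unique k h).
rewrite (terminal (ckappa ⊤ ∘ h)) cat_assoc.
by rewrite -(initial (k ∘ ckappa ⊤)).
Qed.

Lemma factors_tautology A B (f : A ⊢ B) (h : ⊤ ⊢ B) :
  factors_bot f \/ factors_top f -> f ≡ h ∘ hkappa A.
Proof.
case=> [[k ->]|[k ->]]; last by rewrite (arr_from_top_unique k h).
rewrite (initial (h ∘ hkappa ⊥)) -cat_assoc.
by rewrite -(terminal (hkappa ⊥ ∘ k)).
Qed.

(** In a cut-free arrow only the identities of letters contribute to the image.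
The delicate case is a pairing of an arrow through [⊥] with an arrow through
[⊤]: its source is a contradiction, so both components factor through [⊥].
Dually, the target of such a copairing is a tautology, and both components
factor through [⊤]. *)
Lemma G_eq0_factors A B (f : A ⊢ B) :
  G f = set0 -> factors_bot f \/ factors_top f.
Proof.
elim: {A B f} (cut_elimination f) => //.
- move=> p h eh e0; have /setP/(_ (ord0, ord0)) := G_sound eh.
  by rewrite e0 mem_Id in_set0.
- by move=> A h _; right; exists (Id ⊤); apply: arr_to_top_unique.
- by move=> B h _; left; exists (Id ⊥); apply: arr_from_bot_unique.
- move=> A B1 B2 f1 f2 h _ IH1 _ IH2 eh e0.
  have e1 : f1 ≡ hk1 B1 B2 ∘ h by rewrite eh hk1_pairing.
  have e2 : f2 ≡ hk2 B1 B2 ∘ h by rewrite eh hk2_pairing.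
  have {}IH1 := IH1 (etrans (G_sound e1) (G_comp_eq0 (or_intror e0))).
  have {}IH2 := IH2 (etrans (G_sound e2) (G_comp_eq0 (or_intror e0))).
  have bot (k : A ⊢ ⊥) : factors_bot h.
    exists k.
    rewrite eh (factors_contradiction k IH1) (factors_contradiction k IH2).
    by rewrite -pairing_comp -(initial (pairing _ _)).
  case: (IH1) => [[k _]|[k1 ek1]]; first by left; apply: bot.
  case: (IH2) => [[k _]|[k2 ek2]]; first by left; apply: bot.
  by right; exists (pairing k1 k2); rewrite eh ek1 ek2 pairing_comp.
- move=> A1 A2 B f1 f2 h _ IH1 _ IH2 eh e0.
  have e1 : f1 ≡ h ∘ ck1 A1 A2 by rewrite eh copairing_ck1.
  have e2 : f2 ≡ h ∘ ck2 A1 A2 by rewrite eh copairing_ck2.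
  have {}IH1 := IH1 (etrans (G_sound e1) (G_comp_eq0 (or_introl e0))).
  have {}IH2 := IH2 (etrans (G_sound e2) (G_comp_eq0 (or_introl e0))).
  have top (k : ⊤ ⊢ B) : factors_top h.
    exists k.
    rewrite eh (factors_tautology k IH1) (factors_tautology k IH2).
    by rewrite -comp_copairing -(terminal (copairing _ _)).
  case: (IH1) => [[k1 ek1]|[k _]]; last by right; apply: top.
  case: (IH2) => [[k2 ek2]|[k _]]; last by right; apply: top.
  by left; exists (copairing k1 k2); rewrite eh ek1 ek2 comp_copairing.
- move=> i A1 A2 B f h _ IH eh; rewrite (G_sound eh) => /G_comp_proj_eq0/IH.
  case=> -[k ek]; [left; exists (k ∘ proj i A1 A2) | right; exists k].
    by rewrite eh ek cat_assoc.
  by rewrite eh ek -cat_assoc -(terminal (hkappa _ ∘ _)).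
- move=> i A B1 B2 f h _ IH eh; rewrite (G_sound eh) => /G_inj_comp_eq0/IH.
  case=> -[k ek]; [left; exists k | right; exists (inj i B1 B2 ∘ k)].
    by rewrite eh ek cat_assoc -(initial (_ ∘ ckappa _)).
  by rewrite eh ek -cat_assoc.
Qed.

Lemma G_eq0_unique A B (f g : A ⊢ B) : G f = set0 -> G g = set0 -> f ≡ g.
Proof.
move=> /G_eq0_factors ff /G_eq0_factors fg.
case: (ff) => -[k ek].
  by rewrite (factors_contradiction k ff) (factors_contradiction k fg).
by rewrite (factors_tautology k ff) (factors_tautology k fg).
Qed.

(** * Factoring through a projection or an injection *)

Definition source_within i A1 A2 B (f : A1 ∧ A2 ⊢ B) :=
  forall x y, ((place (~~ i) Conj A1 A2 x, y) \in G f) = false.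

Definition target_within i A B1 B2 (f : A ⊢ B1 ∨ B2) :=
  forall x y, ((x, place (~~ i) Disj B1 B2 y) \in G f) = false.

(** If [f] is [f' ∘ proj (~~ i)], its image is empty, so [f'] factors through a
constant.  If it goes through [⊤], the projection may be exchanged for
[proj i]; if it goes through [⊥], the conjunct [side (~~ i) A1 A2] is a
contradiction.  Induction on [B] reduces the other arrows to this case. *)
Lemma source_within_factors i A1 A2 B (f : A1 ∧ A2 ⊢ B) :
  source_within i f ->
  contradiction (side (~~ i) A1 A2) \/
  exists f' : side i A1 A2 ⊢ B, f ≡ f' ∘ proj i A1 A2.
Proof.
have left_case C (g : A1 ∧ A2 ⊢ C) :
    source_within i g ->
    left_shape g ->
    contradiction (side (~~ i) A1 A2) \/
    exists f' : side i A1 A2 ⊢ C, g ≡ f' ∘ proj i A1 A2.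
  move=> av [j [g' [_ eg]]].
  case: (eq_or_negb i j) => ij; case: _ / ij g' eg => g' eg.
    by right; exists g'.
  have /G_eq0_factors : G g' = set0.
    apply/setP=> -[x y]; rewrite in_set0 -(mem_comp_proj (i := ~~ i)).
    by rewrite -(G_sound eg) av.
  case=> -[k ek]; [left; exact: inhabits|right].
  exists (k ∘ hkappa _).
  rewrite eg ek -!cat_assoc -(terminal (hkappa _ ∘ proj (~~ i) _ _)).
  by rewrite -(terminal (hkappa _ ∘ proj i _ _)).
have avoid_comp C D (g : A1 ∧ A2 ⊢ C) (h : C ⊢ D) :
    source_within i g ->
    source_within i (h ∘ g).
  by move=> av x y; apply/mem_comp => -[z []]; rewrite av.
elim: B f => [p|||[] B1 IH1 B2 IH2] f av.
- by case: (arr_shape f) => //; apply: left_case.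
- by right; exists (hkappa _); rewrite -(terminal f) -(terminal (_ ∘ _)).
- by case: (arr_shape f) => //; apply: left_case.
- have [|[f1 e1]] := IH1 _ (avoid_comp _ _ f (hk1 B1 B2) av); first by left.
  have [|[f2 e2]] := IH2 _ (avoid_comp _ _ f (hk2 B1 B2) av); first by left.
  by right; exists (pairing f1 f2); rewrite -(pairing_eta f) e1 e2 pairing_comp.
- case: (arr_shape f) => //; first exact: left_case.
  case=> j [f' [_ ef]].
  have av' : source_within i f'.
    by move=> x y; rewrite -(mem_inj_comp (i := j)) -(G_sound ef).
  have [|[g eg]] : contradiction (side (~~ i) A1 A2) \/
      exists g : side i A1 A2 ⊢ side j B1 B2, f' ≡ g ∘ proj i A1 A2.
    by case: j f' av' {ef} => f' av'; [apply: IH1 | apply: IH2].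
    by left.
  by right; exists (inj j B1 B2 ∘ g); rewrite ef eg cat_assoc.
Qed.

Lemma target_within_factors i A B1 B2 (f : A ⊢ B1 ∨ B2) :
  target_within i f ->
  tautology (side (~~ i) B1 B2) \/
  exists f' : A ⊢ side i B1 B2, f ≡ inj i B1 B2 ∘ f'.
Proof.
have right_case C (g : C ⊢ B1 ∨ B2) :
    target_within i g -> right_shape g ->
    tautology (side (~~ i) B1 B2) \/
    exists f' : C ⊢ side i B1 B2, g ≡ inj i B1 B2 ∘ f'.
  move=> av [j [g' [_ eg]]].
  case: (eq_or_negb i j) => ij; case: _ / ij g' eg => g' eg.
    by right; exists g'.
  have /G_eq0_factors : G g' = set0.
    apply/setP=> -[x y]; rewrite in_set0 -(mem_inj_comp (i := ~~ i)).
    by rewrite -(G_sound eg) av.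
  case=> -[k ek]; [right|left; exact: inhabits].
  exists (ckappa _ ∘ k).
  rewrite eg ek !cat_assoc -(initial (inj (~~ i) _ _ ∘ ckappa _)).
  by rewrite -(initial (inj i _ _ ∘ ckappa _)).
have within_comp C D (g : C ⊢ B1 ∨ B2) (h : D ⊢ C) :
    target_within i g -> target_within i (g ∘ h).
  by move=> av x y; apply/mem_comp => -[z []]; rewrite av.
elim: A f => [p|||[] A1 IH1 A2 IH2] f av.
- by case: (arr_shape f) => //; apply: right_case.
- by case: (arr_shape f) => //; apply: right_case.
- by right; exists (ckappa _); rewrite -(initial f) -(initial (_ ∘ _)).
- case: (arr_shape f) => //; last exact: right_case.
  case=> j [f' [_ ef]].
  have av' : target_within i f'.
    by move=> x y; rewrite -(mem_comp_proj (i := j)) -(G_sound ef).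
  have [|[g eg]] : tautology (side (~~ i) B1 B2) \/
      exists g : side j A1 A2 ⊢ side i B1 B2, f' ≡ inj i B1 B2 ∘ g.
    by case: j f' av' {ef} => f' av'; [apply: IH1 | apply: IH2].
    by left.
  by right; exists (g ∘ proj j A1 A2); rewrite ef eg cat_assoc.
- have [|[f1 e1]] := IH1 _ (within_comp _ _ f (ck1 A1 A2) av); first by left.
  have [|[f2 e2]] := IH2 _ (within_comp _ _ f (ck2 A1 A2) av); first by left.
  right; exists (copairing f1 f2).
  by rewrite -(copairing_eta f) e1 e2 comp_copairing.
Qed.

(** A cut-free arrow from a disjunction-free formula into a disjunction is a
chain of projections that ends in an injection or in an arrow from [⊥].  The
projections can be moved to the other side of the injection. *)
Lemma disj_free_factors A B1 B2 (f : A ⊢ B1 ∨ B2) :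
  ~ occurs_in Disj A ->
  exists i (f' : A ⊢ side i B1 B2), f ≡ inj i B1 B2 ∘ f'.
Proof.
have right_case C (g : C ⊢ B1 ∨ B2) : right_shape g ->
    exists i (f' : C ⊢ side i B1 B2), g ≡ inj i B1 B2 ∘ f'.
  by case=> i [f' [_ ef]]; exists i, f'.
elim: A f => [p|||[] A1 IH1 A2 IH2] f /= free.
- by case: (arr_shape f) => //; apply: right_case.
- by case: (arr_shape f) => //; apply: right_case.
- by exists true, (ckappa B1); rewrite -(initial f) -(initial (_ ∘ _)).
- case: (arr_shape f) => //; last exact: right_case.
  case=> j [f' [_ ef]].
  have [i [h eh]] : exists i (h : side j A1 A2 ⊢ side i B1 B2),
      f' ≡ inj i B1 B2 ∘ h.
    by case: j f' {ef} => f'; [apply: IH1 | apply: IH2]; tauto.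
  by exists i, (h ∘ proj j A1 A2); rewrite ef eh cat_assoc.
- by case: free; left.
Qed.

Lemma conj_free_factors A1 A2 B (f : A1 ∧ A2 ⊢ B) :
  ~ occurs_in Conj B ->
  exists i (f' : side i A1 A2 ⊢ B), f ≡ f' ∘ proj i A1 A2.
Proof.
have left_case C (g : A1 ∧ A2 ⊢ C) : left_shape g ->
    exists i (f' : side i A1 A2 ⊢ C), g ≡ f' ∘ proj i A1 A2.
  by case=> i [f' [_ ef]]; exists i, f'.
elim: B f => [p|||[] B1 IH1 B2 IH2] f /= free.
- by case: (arr_shape f) => //; apply: left_case.
- by exists true, (hkappa A1); rewrite -(terminal f) -(terminal (_ ∘ _)).
- by case: (arr_shape f) => //; apply: left_case.
- by case: free; left.
- case: (arr_shape f) => //; first exact: left_case.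
  case=> j [f' [_ ef]].
  have [i [h eh]] : exists i (h : side i A1 A2 ⊢ side j B1 B2),
      f' ≡ h ∘ proj i A1 A2.
    by case: j f' {ef} => f'; [apply: IH1 | apply: IH2]; tauto.
  by exists i, (inj j B1 B2 ∘ h); rewrite ef eh cat_assoc.
Qed.

(** * Normality *)

Lemma sub_side C i xi A1 A2 :
  subformula C (side i A1 A2) -> subformula C (Bin xi A1 A2).
Proof. by case: i; [apply: sub_left | apply: sub_right]. Qed.

Lemma bot_normal_side i xi A1 A2 :
  bot_normal (Bin xi A1 A2) -> bot_normal (side i A1 A2).
Proof.
by move=> n C D c [] s; apply: n c _; [left | right]; apply: sub_side s.
Qed.

Lemma top_normal_side i xi A1 A2 :
  top_normal (Bin xi A1 A2) -> top_normal (side i A1 A2).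
Proof.
by move=> n C D c [] s; apply: n c _; [left | right]; apply: sub_side s.
Qed.

Lemma bot_normal_disj_free i A1 A2 :
  bot_normal (A1 ∧ A2) -> contradiction (side (~~ i) A1 A2) ->
  ~ occurs_in Disj (side i A1 A2).
Proof.
by case: i => n c; apply: (n _ _ c); [left | right]; apply: sub_refl.
Qed.

Lemma top_normal_conj_free i A1 A2 :
  top_normal (A1 ∨ A2) -> tautology (side (~~ i) A1 A2) ->
  ~ occurs_in Conj (side i A1 A2).
Proof.
by case: i => n c; apply: (n _ _ c); [left | right]; apply: sub_refl.
Qed.

(** * Coherence *)

Definition coherent A B := forall f g : A ⊢ B, G f = G g -> f ≡ g.

Lemma coherent_proj_proj A1 A2 B (f g : A1 ∧ A2 ⊢ B) :
  (forall i, coherent (side i A1 A2) B) ->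
  G f = G g -> left_shape f -> left_shape g -> f ≡ g.
Proof.
move=> IH; case=> + [i [f' [_ ef]]] [j [g' [_ eg]]].
rewrite (G_sound ef) (G_sound eg).
case: (eq_or_negb i j) => ij; case: _ / ij g' eg => g' eg.
  move=> /G_comp_proj_inj e.
  by rewrite ef eg (IH _ _ _ e).
move=> e; have e0 := G_comp_proj_clash e.
by apply: G_eq0_unique; rewrite ?(G_sound ef) ?(G_sound eg) -?e.
Qed.

Lemma coherent_inj_inj A B1 B2 (f g : A ⊢ B1 ∨ B2) :
  (forall i, coherent A (side i B1 B2)) ->
  G f = G g -> right_shape f -> right_shape g -> f ≡ g.
Proof.
move=> IH; case=> + [i [f' [_ ef]]] [j [g' [_ eg]]].
rewrite (G_sound ef) (G_sound eg).
case: (eq_or_negb i j) => ij; case: _ / ij g' eg => g' eg.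
  move=> /G_inj_comp_inj e.
  by rewrite ef eg (IH _ _ _ e).
move=> e; have e0 := G_inj_comp_clash e.
by apply: G_eq0_unique; rewrite ?(G_sound ef) ?(G_sound eg) -?e.
Qed.

(** The case for which normality is needed: it is reduced to that of two
projections or to that of two injections by giving [f] an injection as last
factor or [g] a projection as first factor. *)
Lemma coherent_proj_inj A1 A2 B1 B2 (f g : A1 ∧ A2 ⊢ B1 ∨ B2) :
  bot_normal (A1 ∧ A2) \/ top_normal (B1 ∨ B2) ->
  (forall i, coherent (side i A1 A2) (B1 ∨ B2)) ->
  (forall i, coherent (A1 ∧ A2) (side i B1 B2)) ->
  G f = G g -> left_shape f -> right_shape g -> f ≡ g.
Proof.
move=> normal IHA IHB e [i [f' [cf ef]]] [j [g' [cg eg]]].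
have sf : left_shape f by exists i, f'.
have sg : right_shape g by exists j, g'.
case: normal => normal.
  have within : source_within i g'.
    move=> x y; rewrite -(mem_inj_comp (i := j)) -(G_sound eg) -e (G_sound ef).
    exact: mem_comp_proj_neq.
  have [contra|[h eh]] := source_within_factors within.
    have [k [h eh]] := disj_free_factors f' (bot_normal_disj_free normal contra).
    apply: coherent_inj_inj => //; exists k, (h ∘ proj i A1 A2).
    by split; [exact: cut_elimination | rewrite ef eh cat_assoc].
  apply: coherent_proj_proj => //; exists i, (inj j B1 B2 ∘ h).
  by split; [exact: cut_elimination | rewrite eg eh cat_assoc].
have within : target_within j f'.
  move=> x y; rewrite -(mem_comp_proj (i := i)) -(G_sound ef) e (G_sound eg).
  exact: mem_inj_comp_neq.
have [taut|[h eh]] := target_within_factors within.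
  have [k [h eh]] := conj_free_factors g' (top_normal_conj_free normal taut).
  apply: coherent_proj_proj => //; exists k, (inj j B1 B2 ∘ h).
  by split; [exact: cut_elimination | rewrite eg eh cat_assoc].
apply: coherent_inj_inj => //; exists j, (h ∘ proj i A1 A2).
by split; [exact: cut_elimination | rewrite ef eh cat_assoc].
Qed.

Lemma coherent_pairing A B1 B2 :
  (forall i, coherent A (side i B1 B2)) -> coherent A (B1 ∧ B2).
Proof.
move=> IH f g e; rewrite -(pairing_eta f) -(pairing_eta g).
rewrite (IH true (hk1 B1 B2 ∘ f) (hk1 B1 B2 ∘ g)) /= ?e //.
by rewrite (IH false (hk2 B1 B2 ∘ f) (hk2 B1 B2 ∘ g)) //= e.
Qed.

Lemma coherent_copairing A1 A2 B :
  (forall i, coherent (side i A1 A2) B) -> coherent (A1 ∨ A2) B.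
Proof.
move=> IH f g e; rewrite -(copairing_eta f) -(copairing_eta g).
rewrite (IH true (f ∘ ck1 A1 A2) (g ∘ ck1 A1 A2)) /= ?e //.
by rewrite (IH false (f ∘ ck2 A1 A2) (g ∘ ck2 A1 A2)) //= e.
Qed.

Lemma id_shape_unique A B (f g : A ⊢ B) : id_shape f -> id_shape g -> f ≡ g.
Proof.
case: A f g => // p; case: B => // q f g [e1 ->] [e2 ->].
by rewrite (eq_irrelevance e1 e2).
Qed.

Theorem mainTheorem10 (A B : formula) (f g : A ⊢ B) :
  G f = G g -> bot_normal A \/ top_normal B -> f ≡ g.
Proof.
move=> e normal; move: normal f g e; rewrite -/(coherent A B).
have [n] := ubnP (formula_size A + formula_size B).
elim: n A B => // n IHn A B; rewrite ltnS => le_n normal.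
have IHA xi A1 A2 i : A = Bin xi A1 A2 -> coherent (side i A1 A2) B.
  move=> eA; apply: IHn.
    by apply: leq_trans le_n; rewrite eA ltn_add2r (size_side _ xi).
  case: normal => nrm; [left | by right].
  by move: nrm; rewrite eA; apply: bot_normal_side.
have IHB xi B1 B2 i : B = Bin xi B1 B2 -> coherent A (side i B1 B2).
  move=> eB; apply: IHn.
    by apply: leq_trans le_n; rewrite eB ltn_add2l (size_side _ xi).
  case: normal => nrm; [by left | right].
  by move: nrm; rewrite eB; apply: top_normal_side.
case: B {IHn le_n} normal IHA IHB => [q|||[] B1 B2] normal IHA IHB.
- case: A normal IHA IHB => [p|||[] A1 A2] _ IHA _ f g e.
  + case: (arr_shape f) => // sf; case: (arr_shape g) => // sg.
    exact: id_shape_unique.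
  + exact: arr_from_top_unique.
  + exact: arr_from_bot_unique.
  + case: (arr_shape f) => // sf; case: (arr_shape g) => // sg.
    by apply: coherent_proj_proj => // i; apply: IHA.
  + by apply: coherent_copairing e => i; apply: IHA.
- by move=> f g _; apply: arr_to_top_unique.
- by move=> f g _; apply: arr_to_bot_unique.
- by apply: coherent_pairing => i; apply: IHB.
case: A normal IHA IHB => [p|||[] A1 A2] normal IHA IHB f g e.
- case: (arr_shape f) => // sf; case: (arr_shape g) => // sg.
  by apply: coherent_inj_inj => // i; apply: IHB.
- exact: arr_from_top_unique.
- exact: arr_from_bot_unique.
- have {}IHA i : coherent (side i A1 A2) (B1 ∨ B2) by exact: IHA.
  have {}IHB i : coherent (A1 ∧ A2) (side i B1 B2) by exact: IHB.
  case: (arr_shape f) => // sf; case: (arr_shape g) => // sg.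
  + exact: coherent_proj_proj.
  + exact: coherent_proj_inj.
  + by apply: arr_sym; apply: coherent_proj_inj.
  + exact: coherent_inj_inj.
- by apply: coherent_copairing e => i; apply: IHA.
Qed.
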